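(* Let $X_1,\dots,X_n$ be independent and identically distributed real random variables with distribution function $F$, let $X_{1:n}\le\cdots\le X_{n:n}$ be their order statistics, and let $1\le r\le n$. Then for all real $x,t$, $$P\{X_1\le x,\ X_{r:n}\le t\}=\begin{cases} F(x)\displaystyle\sum_{i=r-1}^{n-1}\binom{n-1}{i}F(t)^i(1-F(t))^{n-1-i}, & x\le t,\\[2mm] F(x)\displaystyle\sum_{i=r-1}^{n-1}\binom{n-1}{i}F(t)^i(1-F(t))^{n-1-i}-\binom{n-1}{r-1}(F(x)-F(t))F(t)^{r-1}(1-F(t))^{n-r}, & x>t.\end{cases}$$
   Context: $F(x)=P\{X_1\le x\}$. The $r$th order statistic $X_{r:n}$ is the $r$th smallest value among $X_1,\dots,X_n$. The convention $0^0=1$ is used. *)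

(* Defs.v *)
From HB Require Import structures.
From mathcomp Require Import all_boot all_order all_algebra.
From mathcomp Require Import all_classical all_reals all_analysis.

Set Implicit Arguments.
Unset Strict Implicit.
Unset Printing Implicit Defensive.

Import Order.TTheory GRing.Theory Num.Theory.

Local Open Scope classical_set_scope.
Local Open Scope ring_scope.

Section iid.
Context d (T : measurableType d) (R : realType) (P : probability T R).
Context (I : finType) (X : I -> {RV P >-> R}).

Definition mutually_independent : Prop :=
  forall (J : {set I}) (A : I -> set R), (forall i, measurable (A i)) ->
    P (\bigcap_(i in [set i | i \in J]) (X i @^-1` A i)) =
    (\prod_(i in J) P (X i @^-1` A i))%E.

Definition identically_distributed : Prop :=
  forall (i j : I) (A : set R), measurable A ->
    distribution P (X i) A = distribution P (X j) A.

End iid.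

(* The rank r is counted from 1, so 1 <= r <= n is the meaningful range. *)
Definition order_statistic (R : realType) (n : nat) (x : 'I_n -> R) (r : nat) : R :=
  nth 0 (sort <=%R [seq x i | i <- enum 'I_n]) r.-1.

(* Main.v *)
Require Import Defs.
From HB Require Import structures.
From mathcomp Require Import all_boot all_order all_algebra.
From mathcomp Require Import all_classical all_reals all_analysis.
From mathcomp Require Import ring.

Import Order.TTheory GRing.Theory Num.Theory.
Local Open Scope classical_set_scope.
Local Open Scope ring_scope.

(** The rank condition on [order_statistic] only counts how many of the
    variables are at most [t]: [X_{r:n} <= t] holds exactly when at least [r] of
    them are ([order_statistic_le]).  Singling out [X_1], write [K] for the number
    of the other [n - 1] variables that are at most [t].  The count is [K + 1] when
    [X_1 <= t] and [K] when [X_1 > t].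

    Since [K] depends on the other variables only, it is independent of [X_1] and
    it is binomial with parameters [n - 1] and [F t].  Hence, for a Borel set [B],
    the probability of [X_1 \in B, K >= k] is the product of the probability of
    [X_1 \in B] and of the binomial tail from [k] ([prob_others_below_ge]).  This
    is obtained directly from the product rule: the event is cut according to the
    exact set [J] of other indices whose variable is at most [t], each piece is an
    intersection of preimages with probability
    [P (X_1 \in B) * F t ^+ #|J| * (1 - F t) ^+ (n - 1 - #|J|)]
    ([prob_others_below_eq]), and the sets [J] are grouped by cardinal.

    If [x <= t], then [X_1 <= x] forces [X_1 <= t], so the event is
    [X_1 <= x, K >= r - 1].  If [x > t], it is the disjoint union of
    [X_1 <= t, K >= r - 1] and [t < X_1 <= x, K >= r]; the two tails differ by the
    single binomial term of index [r - 1], which is the correction in the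
    formula. *)

(** In the sorted sequence the values at most [t] form a prefix whose length is
    their number, so the entry of position [r.-1] lies in it exactly when that
    number is at least [r]. *)
Lemma order_statistic_le {R : realType} {n : nat} (x : 'I_n -> R) (r : nat)
    (t : R) : (0 < r <= n)%N ->
  (order_statistic x r <= t) = (r <= #|[set i | (x i <= t)%R]%SET|)%N.
Proof.
case: r => [//|k] /= k_lt_n; rewrite /order_statistic /=.
set s := sort _ _.
have s_sorted : sorted <=%O s by exact: sort_le_sorted.
have -> : #|[set i | x i <= t]%SET| = count (<= t) s.
  rewrite count_sort count_map cardsE cardE size_filter enumT; exact: eq_count.
case: (ltnP k (count (<= t) s)) => [k_lt|k_ge].
  exact: nth_count_le.
apply/negbTE; rewrite -ltNge; apply: DualTotalTheory.nth_count_gt => //.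
by rewrite k_ge size_sort size_map size_enum_ord.
Qed.

(** The random set [others_below] below takes finitely many values; this
    decomposition lets its events be handled one value at a time. *)
Lemma setI_preimage_fibers {T : Type} {I : finType} (E : set T) (f : T -> I)
    (Q : pred I) :
  [set w | E w /\ Q (f w)] =
  \bigcup_(i in [set` enum Q]) [set w | E w /\ f w = i].
Proof.
apply/seteqP; split => [w [Ew Qw]|w [i Qi [Ew fwi]]] /=.
  by exists (f w); rewrite //= mem_enum.
by rewrite fwi; move: Qi; rewrite /= mem_enum.
Qed.

Lemma measurable_fibers {d : measure_display} {T : measurableType d}
    {I : finType} (E : set T) (f : T -> I) (Q : pred I) :
  (forall i, measurable [set w | E w /\ f w = i]) ->
  measurable [set w | E w /\ Q (f w)].
Proof.
by move=> mE; rewrite setI_preimage_fibers; exact: fin_bigcup_measurable.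
Qed.

Lemma measure_sum_fibers {d : measure_display} {T : measurableType d}
    {R : realType} (mu : {measure set T -> \bar R}) {I : finType}
    (E : set T) (f : T -> I) (Q : pred I) :
  (forall i, measurable [set w | E w /\ f w = i]) ->
  mu [set w | E w /\ Q (f w)] = (\sum_(i | Q i) mu [set w | E w /\ f w = i])%E.
Proof.
move=> mE; rewrite setI_preimage_fibers measure_fin_bigcup //.
  by rewrite -fsbig_seq ?enum_uniq // big_enum.
by move=> i j _ _ [w [[_ <-] [_ <-]]].
Qed.

(** The binomial coefficients of the result appear here, as the number of subsets
    of each cardinal. *)
Lemma sum_subsets_card {R : nmodType} {I : finType} (D : {set I})
    (k : nat) (g : nat -> R) :
  \sum_(J : {set I} | (J \subset D) && (k <= #|J|)%N) g #|J| =
  \sum_(k <= i < #|D|.+1) g i *+ 'C(#|D|, i).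
Proof.
rewrite (partition_big (fun J : {set I} => inord #|J| : 'I_#|D|.+1)
  (fun i : 'I_#|D|.+1 => (k <= i)%N)) /=; last first.
  by move=> J /andP[/subset_leq_card JD kJ]; rewrite inordK.
rewrite big_geq_mkord; apply: eq_bigr => i k_le_i.
rewrite -cards_draws -sumr_const; apply: eq_big => [J|J].
  rewrite inE; case: (boolP (J \subset D)) => //= /subset_leq_card JD.
  rewrite -val_eqE /= inordK //.
  by case: eqP => [->|]; rewrite ?k_le_i ?andbF.
by move=> /andP[/andP[/subset_leq_card JD _] /eqP <-]; rewrite inordK.
Qed.

Definition binomial_tail {R : realType} (m k : nat) (p : R) : R :=
  \sum_(k <= i < m.+1) 'C(m, i)%:R * p ^+ i * (1 - p) ^+ (m - i).

Lemma binomial_tail_recl {R : realType} {m k : nat} (p : R) : (k <= m)%N ->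
  binomial_tail m k p =
  'C(m, k)%:R * p ^+ k * (1 - p) ^+ (m - k) + binomial_tail m k.+1 p.
Proof. by move=> km; rewrite /binomial_tail big_ltn. Qed.

Section OthersBelow.
Context {d : measure_display} {T : measurableType d} {R : realType}.
Context {P : probability T R} {I : finType} (X : I -> {RV P >-> R}) (i0 : I).

Definition others_below (t : R) (w : T) : {set I} :=
  [set i | (i != i0) && (X i w <= t)%R]%SET.

(** The box whose preimage is the event that [X i0] is in [B] and that [J] is the
    set of other indices whose variable is at most [t]; this puts the event in the form to which the
    product rule of independence applies. *)
Definition pattern_set (t : R) (J : {set I}) (B : set R) (i : I) : set R :=
  if i == i0 then B else
  if i \in J then [set` `]-oo, t]] else [set` `]t, +oo[].

Lemma others_belowE (t : R) (B : set R) (J : {set I}) : i0 \notin J ->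
  [set w | B (X i0 w) /\ others_below t w = J] =
  \bigcap_(i in [set i | i \in [set: I]%SET]) (X i @^-1` pattern_set t J B i).
Proof.
move=> i0J; apply/seteqP; split => [w [Bw <-] i _|w wJ] /=.
  rewrite /pattern_set; case: eqP => [-> //|/eqP ii0].
  by rewrite !inE ii0 /=; case: leP => h; rewrite /= in_itv /= ?h.
split; first by have := wJ i0; rewrite /= inE /pattern_set eqxx; exact.
apply/setP => i; rewrite !inE; have [-> |ii0] /= := eqVneq i i0.
  by rewrite (negbTE i0J).
have := wJ i; rewrite /= inE /pattern_set (negbTE ii0) => /(_ isT).
by case: (i \in J); rewrite /= in_itv /= ?andbT // leNgt => ->.
Qed.

Lemma measurable_pattern_set (t : R) (J : {set I}) (B : set R) (i : I) :
  measurable B -> measurable (pattern_set t J B i).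
Proof.
by move=> mB; rewrite /pattern_set; case: ifP => // _; case: ifP => _;
  exact: measurable_itv.
Qed.

Lemma measurable_others_below (t : R) (B : set R) (J : {set I}) :
  measurable B -> measurable [set w | B (X i0 w) /\ others_below t w = J].
Proof.
move=> mB; have [i0J|i0J] := boolP (i0 \in J).
  rewrite (_ : [set w | _] = set0) //; apply/seteqP; split => // w [_ wJ].
  by move: i0J; rewrite -wJ !inE eqxx.
rewrite others_belowE //; apply: fin_bigcap_measurable => // i _.
by apply: measurable_funPTI; exact: measurable_pattern_set.
Qed.

Lemma measurable_others_below_ge (t : R) (B : set R) (k : nat) :
  measurable B ->
  measurable [set w | B (X i0 w) /\ (k <= #|others_below t w|)%N].
Proof.
move=> mB; apply: (measurable_fibers (X i0 @^-1` B) (others_below t)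
  (fun J => (k <= #|J|)%N)) => J.
exact: measurable_others_below.
Qed.

Lemma measurable_preimage_itv (i : I) (A : interval R) :
  measurable (X i @^-1` [set` A]).
Proof. by apply: measurable_funPTI; exact: measurable_itv. Qed.

Hypothesis indep : mutually_independent X.
Variable F : R -> R.
Hypothesis F_cdf : forall i y, P (X i @^-1` `]-oo, y]) = (F y)%:E.

Lemma prob_gt (i : I) (t : R) : P (X i @^-1` `]t, +oo[) = (1 - F t)%:E.
Proof.
rewrite -setCitvl preimage_setC probability_setC ?F_cdf //.
exact: measurable_preimage_itv.
Qed.

Lemma prob_itv_oc (i : I) (t x : R) : t <= x ->
  P (X i @^-1` `]t, x]) = (F x - F t)%:E.
Proof.
move=> tx.
have -> : X i @^-1` `]t, x] = X i @^-1` `]-oo, x] `\` X i @^-1` `]-oo, t].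
  apply/seteqP; split => w /=; rewrite !in_itv /=.
    by case/andP => tX ->; split=> //; apply/negP; rewrite -ltNge.
  by case=> -> /negP; rewrite -ltNge => ->.
have mX := measurable_preimage_itv i.
have -> : P (X i @^-1` `]-oo, x] `\` X i @^-1` `]-oo, t]) =
    (P (X i @^-1` `]-oo, x]) - P (X i @^-1` `]-oo, x] `&` X i @^-1` `]-oo, t]))%E.
  by apply: measureD => //; rewrite -ge0_fin_numE ?fin_num_measure.
rewrite setIidr ?F_cdf //.
by move=> w /=; rewrite !in_itv /= => /le_trans; exact.
Qed.

(** Apart from [X i0], each of the #|J| indices in [J] contributes a factor [F t]
    to the product rule, and each of the remaining ones a factor [1 - F t]. *)
Lemma prob_others_below_eq (t : R) (B : set R) (J : {set I}) :
  measurable B -> J \subset [set~ i0]%SET ->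
  P [set w | B (X i0 w) /\ others_below t w = J] =
  (P (X i0 @^-1` B) * (F t ^+ #|J| * (1 - F t) ^+ (#|I|.-1 - #|J|))%:E)%E.
Proof.
move=> mB JI; have i0J : i0 \notin J.
  by apply/negP => /(fintype.subsetP JI); rewrite !inE eqxx.
rewrite others_belowE // indep; last by move=> i; exact: measurable_pattern_set.
rewrite (bigD1 i0) ?inE //= {1}/pattern_set eqxx; congr (_ * _)%E.
rewrite (eq_bigr (fun i => (if i \in J then F t else 1 - F t)%:E)); last first.
  move=> i /andP[_ ii0]; rewrite /pattern_set (negbTE ii0).
  by case: ifP => _; [exact: F_cdf|exact: prob_gt].
rewrite prodEFin; congr (_%:E).
rewrite (bigID (mem J)) /=.
rewrite (eq_big (mem J) (fun=> F t)); first last.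
- by move=> i /andP[_ ->].
- move=> i; rewrite inE /= andbC; case: (boolP (i \in J)) => //= iJ.
  by apply: contraNneq i0J => <-.
rewrite prodr_const; congr (_ * _).
rewrite (eq_big (mem ([set~ i0] :\: J)%SET) (fun=> 1 - F t)); first last.
- by move=> i /andP[_ /negbTE ->].
- by move=> i; rewrite !inE andbC.
by rewrite prodr_const cardsD (finset.setIidPr JI) cardsC1.
Qed.

(** The probability of each value [J] of [others_below t] depends on [J] only
    through its cardinal, and the factor of [X i0] is common to all of them, so
    summing over the [J] with at least [k] elements gives a binomial tail.  The set
    [B] is arbitrary because the proof of the case [t < x] needs it to be
    [`]-oo, t]] and [`]t, x]]. *)
Lemma prob_others_below_ge (t : R) (B : set R) (k : nat) : measurable B ->
  P [set w | B (X i0 w) /\ (k <= #|others_below t w|)%N] =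
  (P (X i0 @^-1` B) * (binomial_tail #|I|.-1 k (F t))%:E)%E.
Proof.
move=> mB.
(* Only subsets of the complement of [i0] occur; making this part of the event
   restricts the sum to the [J] covered by [prob_others_below_eq]. *)
have -> : [set w | B (X i0 w) /\ (k <= #|others_below t w|)%N] =
    [set w | B (X i0 w) /\ (others_below t w \subset [set~ i0]%SET) &&
                           (k <= #|others_below t w|)%N].
  have sub w : others_below t w \subset [set~ i0]%SET.
    by apply/fintype.subsetP => i; rewrite !inE => /andP[].
  by apply/seteqP; split=> w /=; rewrite sub.
transitivity (\sum_(J : {set I} | (J \subset [set~ i0]%SET) && (k <= #|J|)%N)
    (P (X i0 @^-1` B) * (F t ^+ #|J| * (1 - F t) ^+ (#|I|.-1 - #|J|))%:E))%E.
  rewrite (measure_sum_fibers P (X i0 @^-1` B) (others_below t)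
    (fun J => (J \subset [set~ i0]%SET) && (k <= #|J|)%N)); last first.
    by move=> J; exact: measurable_others_below.
  by apply: eq_bigr => J /andP[JI _]; exact: prob_others_below_eq.
have /fineK <- : P (X i0 @^-1` B) \is a fin_num.
  by apply: fin_num_measure; exact: measurable_funPTI.
under eq_bigr do rewrite -EFinM.
rewrite sumEFin -EFinM -mulr_sumr; congr ((_ * _)%:E).
rewrite (sum_subsets_card _ _ (fun j => F t ^+ j * (1 - F t) ^+ (#|I|.-1 - j))).
rewrite cardsC1; apply: eq_bigr => j _.
by rewrite -[LHS]mulr_natl mulrA.
Qed.

End OthersBelow.

Lemma card_le_split {d : measure_display} {T : measurableType d}
    {R : realType} {P : probability T R} {I : finType} (X : I -> {RV P >-> R})
    (i0 : I) (t : R) (w : T) :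
  #|[set i | (X i w <= t)%R]%SET| =
  ((X i0 w <= t)%R + #|others_below X i0 t w|)%N.
Proof.
rewrite (cardsD1 i0) inE; congr (_ + #|pred_of_set _|)%N.
by apply/setP => i; rewrite !inE.
Qed.

Theorem theorem1 (d : measure_display) (T : measurableType d) (R : realType)
    (P : probability T R) (n : nat) (X : 'I_n -> {RV P >-> R}) (F : R -> R)
    (r : nat) (r_gt0 : (1 <= r)%N) (r_le_n : (r <= n)%N)
    (indep : mutually_independent X) (ident : identically_distributed X)
    (X1 := X (Ordinal (leq_trans r_gt0 r_le_n)))
    (F_cdf : forall y : R, cdf X1 y = (F y)%:E) (x t : R) :
  P [set w | X1 w <= x /\ order_statistic (fun i => X i w) r <= t] =
  (if x <= t then
     F x * \sum_(r.-1 <= i < n)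
             'C(n.-1, i)%:R * F t ^+ i * (1 - F t) ^+ (n.-1 - i)
   else
     F x * \sum_(r.-1 <= i < n)
             'C(n.-1, i)%:R * F t ^+ i * (1 - F t) ^+ (n.-1 - i)
     - 'C(n.-1, r.-1)%:R * (F x - F t) * F t ^+ r.-1 * (1 - F t) ^+ (n - r))%:E.
Proof.
set i0 := Ordinal _ in X1 F_cdf *.
have X_cdf i y : P (X i @^-1` `]-oo, y]) = (F y)%:E.
  by rewrite -F_cdf; apply: (ident i i0); exact: measurable_itv.
have tailE : \sum_(r.-1 <= i < n)
      'C(n.-1, i)%:R * F t ^+ i * (1 - F t) ^+ (n.-1 - i) =
    binomial_tail n.-1 r.-1 (F t).
  by rewrite /binomial_tail prednK // (leq_trans r_gt0).
have rankE w : (order_statistic (fun i => X i w) r <= t) =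
    (r <= (X1 w <= t)%R + #|others_below X i0 t w|)%N.
  by rewrite order_statistic_le ?r_gt0 // (card_le_split X i0).
have leq_pred_rank k : (r <= true + k)%N = (r.-1 <= k)%N.
  by rewrite -[in LHS](prednK r_gt0) add1n ltnS.
rewrite tailE; case: leP => [xt|tx].
  have -> : [set w | X1 w <= x /\ order_statistic (fun i => X i w) r <= t] =
      [set w | [set` `]-oo, x]] (X i0 w) /\
               (r.-1 <= #|others_below X i0 t w|)%N].
    apply/seteqP; split => w /=; rewrite rankE in_itv /= => -[X1x];
    by rewrite (le_trans X1x xt) leq_pred_rank.
  by rewrite (prob_others_below_ge _ _ indep _ X_cdf) ?X_cdf ?card_ord.
(* Above [t], the variable [X1] does not count towards the rank, so the others
   must supply [r] values at most [t] instead of [r.-1]. *)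
pose E1 := [set w | [set` `]-oo, t]] (X i0 w) /\
                    (r.-1 <= #|others_below X i0 t w|)%N].
pose E2 := [set w | [set` `]t, x]] (X i0 w) /\
                    (r <= #|others_below X i0 t w|)%N].
have -> : [set w | X1 w <= x /\ order_statistic (fun i => X i w) r <= t] =
    E1 `|` E2.
  apply/seteqP; split => w; rewrite /E1 /E2 /= rankE !in_itv /=.
    case: (leP (X1 w) t) => [X1t|tX1] [X1x]; last by right; rewrite X1x.
    by rewrite leq_pred_rank; left.
  move=> [[X1t]|[/andP[tX1 X1x]]].
    by rewrite X1t leq_pred_rank (le_trans X1t (ltW tx)).
  by rewrite [(X1 w <= t)%R]leNgt tX1.
have -> : P (E1 `|` E2) = (P E1 + P E2)%E.
  apply: measureU.
  - by apply: measurable_others_below_ge; exact: measurable_itv.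
  - by apply: measurable_others_below_ge; exact: measurable_itv.
  - rewrite /E1 /E2; apply/seteqP; split => // w [] /= [+ _] [+ _].
    by rewrite !in_itv /= => X1t /andP[]; rewrite ltNge X1t.
rewrite !(prob_others_below_ge _ _ indep _ X_cdf) ?X_cdf ?card_ord //.
have -> : P (X i0 @^-1` `]t, x]) = (F x - F t)%:E.
  exact/(prob_itv_oc _ _ X_cdf)/ltW.
rewrite -!EFinM -EFinD; congr (_%:E).
rewrite (@binomial_tail_recl _ _ r.-1); last by rewrite -!subn1 leq_sub2r.
rewrite -[(n.-1 - r.-1)%N]subSS !prednK ?(leq_trans r_gt0) //.
ring.
Qed.
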